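(* Let $N\ge 2$ be an integer and let $\boldsymbol{\epsilon}=(\epsilon_1,\dots,\epsilon_N)\in\{\pm1\}^N$ contain at least one $+1$ and at least one $-1$. Then the function $\mathbf{x}\mapsto P_N(\mathbf{x};\boldsymbol{\epsilon})$ has no local maximum in the open cube $(0,1)^{N-1}$.
   Context: For an integer $N\ge 1$, a sign vector $\boldsymbol{\epsilon}=(\epsilon_1,\dots,\epsilon_N)\in\{\pm1\}^N$ and $\mathbf{x}=(x_1,\dots,x_{N-1})\in[0,1]^{N-1}$, define for $1\le i<j\le N$ $$X_{ij}(\mathbf{x})=\prod_{k=i}^{j-1}x_k,\qquad P_N(\mathbf{x};\boldsymbol{\epsilon})=\prod_{1\le i<j\le N}\bigl(1-\epsilon_i\epsilon_jX_{ij}(\mathbf{x})\bigr).$$ A local maximum is not required to be strict: a point $\mathbf{x}\in(0,1)^{N-1}$ is a local maximum if $P_N(\mathbf{x}';\boldsymbol{\epsilon})\le P_N(\mathbf{x};\boldsymbol{\epsilon})$ for all $\mathbf{x}'$ in some neighbourhood of $\mathbf{x}$. *)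

(* Defs.v *)
From mathcomp Require Import all_boot all_order all_algebra.
From mathcomp Require Import all_classical all_reals all_analysis.
Set Implicit Arguments.
Unset Strict Implicit.
Unset Printing Implicit Defensive.
Import Order.TTheory GRing.Theory Num.Theory.
Import numFieldNormedType.Exports.
Local Open Scope classical_set_scope.
Local Open Scope ring_scope.

(* Indices are shifted to start at 0: the signs are indexed by 'I_N and the
   coordinates by 'I_N.-1, so that X i j is the product of the x_k, i <= k < j. *)

Definition sign_vector (R : realType) (N : nat) (eps : 'I_N -> R) : Prop :=
  forall i, eps i = 1 \/ eps i = -1.

Definition X (R : realType) (N : nat) (i j : 'I_N) (x : 'rV[R]_N.-1) : R :=
  \prod_(k < N.-1 | (i <= k < j)%N) x ord0 k.

Definition P (R : realType) (N : nat) (eps : 'I_N -> R) (x : 'rV[R]_N.-1) : R :=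
  \prod_(i < N) \prod_(j < N | (i < j)%N) (1 - eps i * eps j * X i j x).

Definition closed_cube (R : realType) (n : nat) : set 'rV[R]_n :=
  [set x | forall k, 0 <= x ord0 k <= 1].

Definition open_cube (R : realType) (n : nat) : set 'rV[R]_n :=
  [set x | forall k, 0 < x ord0 k < 1].

Arguments closed_cube : clear implicits.
Arguments open_cube : clear implicits.

(* Neighbourhoods are taken relative to the domain D of f. *)
Definition local_max_on (R : realType) (n : nat) (D : set 'rV[R]_n)
    (f : 'rV[R]_n -> R) (x : 'rV[R]_n) : Prop :=
  \forall x' \near within D (nbhs x), f x' <= f x.

(* Main.v *)
Require Import Defs.
From mathcomp Require Import all_boot all_order all_algebra.
From mathcomp Require Import all_classical all_reals all_analysis.
From mathcomp Require Import ring lra.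
Import Order.TTheory GRing.Theory Num.Theory.
Import numFieldNormedType.Exports.
Local Open Scope classical_set_scope.
Local Open Scope ring_scope.

(** Write [X i j = t j / t i] with [t j] the product of the first [j]
    coordinates, and multiply by [s] those [t i] with [eps i = 1].  Factors of
    equal signs do not change; a factor [1 + c] of opposite signs becomes
    [1 + c s] or [1 + c / s], so [log P] is a strictly convex function of
    [log s] and has no local maximum at [s = 1].  Without logarithms: as
    [(1 + c s) (1 + c / s) > (1 + c)^2] for [s <> 1], the product of the values
    of [P] at the parameters [s] and [1 / s] exceeds the square of its value
    at [1]. *)

Lemma X_gt0_lt1 (R : realType) (N : nat) (x : 'rV[R]_N.-1) (i j : 'I_N) :
  open_cube R N.-1 x -> (i < j)%N -> 0 < X i j x < 1.
Proof.
move=> xP ij; apply/andP; split.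
  by apply: prodr_gt0 => k _; case/andP: (xP k).
have iN : (i < N.-1)%N.
  by rewrite (leq_trans ij) // -ltnS prednK ?ltn_ord // (leq_ltn_trans _ (ltn_ord i)).
(* The strict upper bound needs a nonempty product; [k = i] is in range. *)
have h : has (fun k : 'I_N.-1 => (i <= k < j)%N) (index_enum 'I_N.-1).
  by apply/hasP; exists (Ordinal iN); rewrite ?mem_index_enum //= leqnn.
have -> : 1 = \prod_(k < N.-1 | (i <= k < j)%N) (1 : R) by rewrite big1.
by apply: ltr_prod => // k _; case/andP: (xP k) => /ltW -> ->.
Qed.

Lemma sign_factor_gt0 (R : realType) (N : nat) (eps : 'I_N -> R)
    (x : 'rV[R]_N.-1) (i j : 'I_N) :
  sign_vector eps -> open_cube R N.-1 x -> (i < j)%N ->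
  0 < 1 - eps i * eps j * X i j x.
Proof.
move=> heps xP ij; have /andP[] := X_gt0_lt1 _ _ _ _ _ xP ij.
by case: (heps i) => ->; case: (heps j) => -> *; lra.
Qed.

Lemma P_ge0 (R : realType) (N : nat) (eps : 'I_N -> R) (x : 'rV[R]_N.-1) :
  sign_vector eps -> open_cube R N.-1 x -> 0 <= P eps x.
Proof.
move=> heps xP; apply: prodr_ge0 => i _; apply: prodr_ge0 => j ij.
exact/ltW/sign_factor_gt0.
Qed.

(** The coordinates after multiplying each [t i] by [u i]. *)
Definition rescale (R : realType) (m : nat) (u : 'I_m.+1 -> R) (x : 'rV[R]_m) :
    'rV[R]_m :=
  \row_k (x ord0 k * (u (lift ord0 k) / u (widen_ord (leqnSn m) k))).

(** The ratios of consecutive values of [u] telescope over [i <= k < j]. *)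
Lemma X_rescale (R : realType) (m : nat) (u : 'I_m.+1 -> R) (x : 'rV[R]_m)
    (i j : 'I_m.+1) :
  (forall k, u k != 0) -> (i < j)%N ->
  @X R m.+1 i j (rescale R m u x) = @X R m.+1 i j x * (u j / u i).
Proof.
move=> u0 ij; rewrite /X /=.
under eq_bigr do rewrite mxE.
rewrite big_split /=; congr (_ * _).
pose v n := u (inord n).
rewrite (eq_bigr (fun k : 'I_m => v k.+1 / v k)); last first.
  move=> k _; rewrite /v; congr (u _ / u _); apply: val_inj => /=.
    by rewrite inordK // ltnS.
  by rewrite inordK // ltnS ltnW.
rewrite -(big_mkord (fun k => i <= k < j)%N (fun k => v k.+1 / v k)).
have jm : (j <= m)%N by rewrite -ltnS.
transitivity (\prod_(i <= k < j) (v k.+1 / v k)).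
  rewrite (big_nat_widen i j m) // (big_nat_widenl i 0) //.
  by apply: eq_bigl => k; rewrite andbC.
rewrite (telescope_prodf (fun k _ => u0 (inord k)) ij).
by rewrite /v !inord_val.
Qed.

Definition sign_scaling (R : realType) (N : nat) (eps : 'I_N -> R) (s : R)
  (i : 'I_N) : R := if eps i == 1 then s else 1.

(** With [s = exp v], this is strict convexity of [log (1 + c * exp v)], read at the midpoint [0] of
    [v] and [-v]. *)
Lemma mul_add1_gt (R : realType) (c s : R) : 0 < c -> 0 < s -> s != 1 ->
  (1 + c) ^+ 2 < (1 + c * s) * (1 + c / s).
Proof.
move=> c0 s0 s1; rewrite -subr_gt0.
have -> : (1 + c * s) * (1 + c / s) - (1 + c) ^+ 2 = c * (s - 1) ^+ 2 / s.
  by field; rewrite gt_eqF.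
by rewrite divr_gt0 // mulr_gt0 // exprn_even_gt0 //= subr_eq0.
Qed.

(** The products are compared factor by factor: equality at pairs of equal signs, strict inequality
    at pairs of opposite signs, of which there is at least one. *)
Lemma P_rescale_gt (R : realType) (m : nat) (eps : 'I_m.+1 -> R)
    (x : 'rV[R]_m) (s : R) :
  sign_vector eps -> (exists i, eps i = 1) -> (exists i, eps i = -1) ->
  open_cube R m x -> 0 < s -> s != 1 ->
  @P R m.+1 eps x ^+ 2 <
  @P R m.+1 eps (rescale R m (sign_scaling R _ eps s) x) *
  @P R m.+1 eps (rescale R m (sign_scaling R _ eps s^-1) x).
Proof.
move=> heps [a ea] [b eb] xP s0 s1.
pose y1 := rescale R m (sign_scaling R _ eps s) x.
pose y2 := rescale R m (sign_scaling R _ eps s^-1) x.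
rewrite -/y1 -/y2.
have neq1 : (-1 == 1 :> R) = false by apply/negbTE; rewrite lt_eqF //; lra.
have w0 r : 0 < r -> forall k, sign_scaling R _ eps r k != 0.
  move=> r0 k; rewrite /sign_scaling; case: ifP => _; last exact: oner_neq0.
  by rewrite gt_eqF.
have sV0 : 0 < s^-1 by rewrite invr_gt0.
pose F y (p : 'I_m.+1 * 'I_m.+1) : R :=
   1 - eps p.1 * eps p.2 * @X R m.+1 p.1 p.2 y.
have PE y : @P R m.+1 eps y = \prod_(p : 'I_m.+1 * 'I_m.+1 | (p.1 < p.2)%N) F y p.
  by rewrite /P pair_big_dep.
rewrite expr2 !PE -!big_split /=.
have strict (p : 'I_m.+1 * 'I_m.+1) : (p.1 < p.2)%N -> eps p.1 != eps p.2 ->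
    F x p * F x p < F y1 p * F y2 p.
  case: p => i j /= ij; rewrite /F /= !X_rescale //; try exact: w0.
  have /andP[c0 _] := X_gt0_lt1 _ m.+1 _ _ _ xP ij.
  have := mul_add1_gt _ _ _ c0 s0 s1.
  rewrite /sign_scaling; set c := X i j x => H.
  (* For signs [(1, -1)] the factors at [y1], [y2] are [1 + c / s], [1 + c * s]; for [(-1, 1)] they
     are swapped. *)
  have [ei|ei] := heps i; have [ej|ej] := heps j; rewrite ei ej ?eqxx ?neq1 // => _.
    apply: le_lt_trans (lt_le_trans H _); first by lra.
    by rewrite invrK; lra.
  apply: le_lt_trans (lt_le_trans H _); first by lra.
  by rewrite !divr1; lra.
have weak (p : 'I_m.+1 * 'I_m.+1) : (p.1 < p.2)%N ->
    F x p * F x p <= F y1 p * F y2 p.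
  move=> pP; have [ep|] := eqVneq (eps p.1) (eps p.2); last by move/(strict _ pP)/ltW.
  rewrite /F !X_rescale //; try exact: w0.
  rewrite /sign_scaling ep.
  by case: ifP => _; rewrite !divff ?gt_eqF // !mulr1.
have F0 (p : 'I_m.+1 * 'I_m.+1) : (p.1 < p.2)%N -> 0 < F x p.
  exact: (sign_factor_gt0 _ m.+1).
have [q qP qne] : exists2 q : 'I_m.+1 * 'I_m.+1, (q.1 < q.2)%N & eps q.1 != eps q.2.
  case: (ltngtP a b) => [ab|ba|/val_inj ab].
  - by exists (a, b) => //=; rewrite ea eb eq_sym neq1.
  - by exists (b, a) => //=; rewrite ea eb neq1.
  - by move: ea; rewrite ab eb => /eqP; rewrite neq1.
(* Strictness at [q] survives multiplication because the other factors at [x] are positive. *)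
rewrite (bigD1 q) //= [ltRHS](bigD1 q) //=.
apply: lt_le_trans (_ : _ < F y1 q * F y2 q *
  \prod_(p : 'I_m.+1 * 'I_m.+1 | (p.1 < p.2)%N && (p != q)) (F x p * F x p)) _.
  rewrite ltr_pM2r ?strict //.
  by apply: prodr_gt0 => p /andP[pP _]; rewrite mulr_gt0 ?F0.
rewrite ler_pM2l.
  by apply: ler_prod => p /andP[pP _]; rewrite weak // mulr_ge0 ?ltW ?F0.
by apply: lt_trans (strict q qP qne); rewrite mulr_gt0 ?F0.
Qed.

Lemma rescale_entry_cvg (R : realType) (m : nat) (eps : 'I_m.+1 -> R)
    (x : 'rV[R]_m) (k : 'I_m) :
  rescale R m (sign_scaling R _ eps s) x ord0 k @[s --> (1 : R)] --> x ord0 k.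
Proof.
have w i : sign_scaling R _ eps s i @[s --> (1 : R)] --> (1 : R).
  by rewrite /sign_scaling; case: (eps i == 1); [exact: cvg_id | exact: cvg_cst].
under eq_fun do rewrite mxE.
suff h : x ord0 k * (sign_scaling R _ eps s (lift ord0 k) /
    sign_scaling R _ eps s (widen_ord (leqnSn m) k)) @[s --> (1 : R)] -->
    x ord0 k * (1 / 1) by rewrite divr1 mulr1 in h.
apply: cvgM; first exact: cvg_cst.
by apply: cvgM; [exact: w | apply: cvgV; [exact: oner_neq0 | exact: w]].
Qed.

Lemma rescale_cvg (R : realType) (m : nat) (eps : 'I_m.+1 -> R) (x : 'rV[R]_m) :
  rescale R m (sign_scaling R _ eps s) x @[s --> (1 : R)] --> x.
Proof.
apply/cvg_ballP => e e0.
(* Balls of row vectors are entrywise, and there are finitely many entries. *)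
have : \forall s \near (1 : R), forall k,
    ball (x ord0 k) e (rescale R m (sign_scaling R _ eps s) x ord0 k).
  apply: (@filter_forall R _ _ (nbhs (1 : R)) _) => k.
  by have /cvg_ballP := rescale_entry_cvg R m eps x k; apply.
by apply: filterS => s h; split=> // i k; rewrite (ord1 i); exact: h.
Qed.

Theorem lemma5p1 (R : realType) (N : nat) (eps : 'I_N -> R)
    (hN : (2 <= N)%N) (heps : sign_vector eps)
    (hpos : exists i, eps i = 1) (hneg : exists i, eps i = -1) :
  ~ exists x : 'rV[R]_N.-1,
      open_cube R N.-1 x /\ local_max_on (closed_cube R N.-1) (P eps) x.
Proof.
case: N eps hN heps hpos hneg => // m eps _ heps hpos hneg [x [xP xmax]].
pose y s := rescale R m (sign_scaling R _ eps s) x.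
have near1 : \forall s \near (1 : R),
    open_cube R m (y s) /\ @P R m.+1 eps (y s) <= P eps x.
  (* Maximality at [x] only concerns points of the cube, so the curve [y] must stay inside it. *)
  have yP : \forall s \near (1 : R), open_cube R m (y s).
    apply: (@filter_forall R _ _ (nbhs (1 : R)) _) => k.
    have /andP[k0 k1] := xP k.
    have h := rescale_entry_cvg R m eps x k.
    have h0 : \forall s \near (1 : R), 0 < y s ord0 k by exact: (cvgr_gt _ h).
    have h1 : \forall s \near (1 : R), y s ord0 k < 1 by exact: (cvgr_lt _ h).
    by apply: filterS2 h0 h1 => s -> ->.
  have ymax : \forall s \near (1 : R),
      closed_cube R m (y s) -> @P R m.+1 eps (y s) <= P eps x.
    exact: (rescale_cvg R m eps x _ xmax).
  apply: filterS2 yP ymax => s sP smax; split=> //.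
  by apply: smax => k; have /andP[/ltW -> /ltW ->] := sP k.
(* Inversion is continuous and fixes [1], so what holds near [1] also holds at [s^-1]. *)
have inv1 : (s^-1 : R) @[s --> (1 : R)] --> (1^-1 : R).
  by have := @inv_continuous R 1 (oner_neq0 R).
rewrite invr1 in inv1.
have near1V := inv1 _ near1.
have [s [s1 [[ys Pys] [yV PyV]]]] : exists s : R, 1 < s /\
    (open_cube R m (y s) /\ @P R m.+1 eps (y s) <= P eps x) /\
    (open_cube R m (y s^-1) /\ @P R m.+1 eps (y s^-1) <= P eps x).
  (* Approaching [1] from the right guarantees [s != 1]. *)
  apply: (@filter_ex _ (at_right (1 : R))).
  have gt1 : \forall s \near (1 : R)^'+, 1 < s by exact: nbhs_right_gt.
  apply: filterI => //.
  by apply: filterS (filterI near1 near1V) => s.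
have s0 : 0 < s by apply: lt_trans s1.
have := P_rescale_gt R m eps x s heps hpos hneg xP s0.
rewrite gt_eqF // => /(_ isT); apply/negP; rewrite -leNgt expr2.
(* Both values lie between [0] and [P eps x], so their product is at most its square. *)
by apply: ler_pM => //; exact: P_ge0.
Qed.
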